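(* Let $\chi^a$, $1\le a\le n$, be a family of $(p,0)$-forms on $J^\infty\mathrm{Lor}$. Then $$\nabla_a\chi^a\wedge\mathrm{vol}_g=(-1)^p\,d\bigl(\chi^a\wedge\iota_{\hat\partial_a}\mathrm{vol}_g\bigr).$$
   Context: $M$ is a smooth manifold of dimension $n$ and $\mathrm{Lor}\to M$ is the bundle of fibre-wise lorentzian metrics (signature $(-1,1,\dots,1)$). $J^\infty\mathrm{Lor}$ is its infinite jet bundle; $\Omega^{p,q}(J^\infty\mathrm{Lor})$ is the space of forms of vertical degree $p$ and horizontal degree $q$ in the variational bicomplex, with vertical differential $\delta$, horizontal differential $d$, total differential $\mathbf{d}=\delta+d$, and $\mathcal{L}_X=[\iota_X,\mathbf{d}]$. Repeated indices are summed. One works over a coordinate chart of $M$ with coordinates $x^a$ and induced jet coordinates $g_{ab,C}(j^\infty_x\eta)=\partial^{|C|}\eta_{ab}/\partial x^C|_x$, so that $\delta x^a=0$, $dg_{ab,C}=g_{ab,Ce}\,dx^e$, $d\,\delta g_{ab,C}=-\delta g_{ab,Ce}\wedge dx^e$. $\hat\partial_a$ is the horizontal lift of $\partial/\partial x^a$ by the Cartan connection: $\iota_{\hat\partial_a}dx^b=\delta^b_a$, $\iota_{\hat\partial_a}\delta g_{bc,D}=0$. The metric volume form is $\mathrm{vol}_g=\sqrt{-\det g}\;dx^1\wedge\dots\wedge dx^n\in\Omega^{0,n}$. With $\Gamma^a_{bc}=\tfrac12g^{ad}(g_{db,c}+g_{dc,b}-g_{bc,d})$, viewed as functions on the jet bundle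 ($(g^{ab})$ the inverse of $(g_{ab})$), the covariant derivative of a family with an upper index is $\nabla_c\chi^a=\mathcal{L}_{\hat\partial_c}\chi^a+\Gamma^a_{cb}\chi^b$, so $\nabla_a\chi^a=\mathcal{L}_{\hat\partial_a}\chi^a+\Gamma^a_{ab}\chi^b$. *)

(* Defs.v *)
From HB Require Import structures.
From mathcomp Require Import all_boot all_order all_algebra.
From mathcomp Require Import all_classical all_reals all_analysis.

Set Implicit Arguments.
Unset Strict Implicit.
Unset Printing Implicit Defensive.

Import Order.TTheory GRing.Theory Num.Theory.
Import numFieldNormedType.Exports.
Import ArrowAsProduct.

Local Open Scope classical_set_scope.
Local Open Scope ring_scope.

(* The variational bicomplex of the bundle of lorentzian metrics over the     *)
(* domain of a coordinate chart, i.e. over an open set U of R^n.              *)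

(* Unordered pairs {a, b}, encoded as sorted pairs, since g_{ab} = g_{ba}. *)
Definition sympair (n : nat) := {ab : 'I_n * 'I_n | (ab.1 <= ab.2)%N}.

Lemma spair_subproof (n : nat) (a b : 'I_n) :
  ((Order.min a b, Order.max a b).1 <= (Order.min a b, Order.max a b).2)%N.
Proof. by rewrite /=; case: (leP a b) => // /ltW. Qed.

Definition spair (n : nat) (a b : 'I_n) : sympair n :=
  exist _ (Order.min a b, Order.max a b) (spair_subproof a b).

(* The multi-index C stands for d^{|C|}/dx^C, C i being the number of         *)
(* derivatives in the direction x^i; Ce is mi_incr C e.                       *)
Definition multiindex (n : nat) := {ffun 'I_n -> nat}.

Definition mi0 (n : nat) : multiindex n := [ffun _ => 0%N].

Definition mi_incr (n : nat) (C : multiindex n) (e : 'I_n) : multiindex n :=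
  [ffun i => (C i + (i == e))%N].

(* The jet coordinates: inl a is x^a and inr ({a, b}, C) is g_{ab,C}. *)
Definition jcoord (n : nat) : Type := ('I_n + sympair n * multiindex n)%type.
HB.instance Definition _ (n : nat) := Choice.on (jcoord n).

Definition jcoord_order (n : nat) (c : jcoord n) : nat :=
  match c with
  | inl _ => 0%N
  | inr (_, C) => (\sum_i C i)%N
  end.

(* The space of all values of the jet coordinates, with the product topology. *)
(* It contains the jets as an open subset (JLor below) and is the tangent     *)
(* space at each of them.                                                     *)
Definition jet (R : realType) (n : nat) : Type := jcoord n -> R.
HB.instance Definition _ (R : realType) (n : nat) :=
  GRing.Lmodule.on (jet R n).
HB.instance Definition _ (R : realType) (n : nat) :=
  Topological.on (jet R n).

Section Jets.
Context {R : realType} {n : nat}.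
Local Notation jet := (jet R n).

Definition xco (a : 'I_n) (z : jet) : R := z (inl a).

Definition gco (a b : 'I_n) (C : multiindex n) (z : jet) : R :=
  z (inr (spair a b, C)).

Definition gmx (z : jet) : 'M[R]_n := \matrix_(a, b) gco a b (mi0 n) z.

(* Signature (-1, 1, ..., 1), for a symmetric matrix. *)
Definition lorentzian (g : 'M[R]_n) : Prop :=
  exists (P : 'M[R]_n) (i0 : 'I_n),
    P \in unitmx /\
    P^T *m g *m P = diag_mx (\row_i (if i == i0 then -1 else 1)).

Definition JLor (U : set 'rV[R]_n) : set jet :=
  [set z | U (\row_a xco a z) /\ lorentzian (gmx z)].

Definition agree_upto (k : nat) (y z : jet) : Prop :=
  forall c : jcoord n, (jcoord_order c <= k)%N -> y c = z c.

(* Derivative at z along the vector v. *)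
Definition along (f : jet -> R) (v z : jet) : R -> R :=
  fun t => f (z + t *: v).

Definition dird (v : jet) (f : jet -> R) (z : jet) : R :=
  derive1 (along f v z) 0.

Fixpoint Ck (k : nat) (O : set jet) (f : jet -> R) : Prop :=
  (forall z, O z -> {for z, continuous f}) /\
  match k with
  | 0%N => True
  | k'.+1 => forall v : jet,
      (forall z, O z -> derivable (along f v z) 0 1) /\ Ck k' O (dird v f)
  end.

Definition smooth_on (O : set jet) (f : jet -> R) : Prop :=
  forall k, Ck k O f.

(* An inhomogeneous form: its component of degree k at the jet z sends the    *)
(* sequence s of k tangent vectors to w z s. Only the values at z in JLor U   *)
(* are meaningful.                                                            *)
Definition jform : Type := jet -> seq jet -> R.

Definition fun_form (f : jet -> R) : jform :=
  fun z s => if s is [::] then f z else 0.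

Definition fscale (f : jet -> R) (w : jform) : jform :=
  fun z s => f z * w z s.

(* Number of pairs i < j with m_i = false and m_j = true: (-1) to this power  *)
(* is the sign of the shuffle that moves the positions selected by m first.   *)
Fixpoint mask_inv (m : seq bool) : nat :=
  if m is b :: m' then ((if b then 0 else count id m') + mask_inv m')%N
  else 0%N.

(* (u /\ w)(v_1,...,v_k) as a sum over shuffles, with no factorials. *)
Definition wedge (u w : jform) : jform := fun z s =>
  \sum_(m : (size s).-tuple bool)
     (-1) ^+ mask_inv m * u z (mask m s) * w z (mask (map negb m) s).

(* Total differential: sum_i (-1)^i v_i(w(v_0,..,^v_i,..,v_k)) for constant   *)
(* vector fields v_i, whose brackets vanish.                                  *)
Definition extd (w : jform) : jform := fun z s =>
  \sum_(i < size s)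
     (-1) ^+ i * dird (nth 0 s i) (fun y => w y (take i s ++ drop i.+1 s)) z.

Definition iota_ (X : jet -> jet) (w : jform) : jform :=
  fun z s => w z (X z :: s).

(* The graded commutator [iota_X, extd], of operators of degrees -1 and 1. *)
Definition lieD (X : jet -> jet) (w : jform) : jform :=
  iota_ X (extd w) + extd (iota_ X w).

(* Horizontal lift of d/dx^a, i.e. d/dx^a + sum g_{bc,Ca} d/dg_{bc,C}: the    *)
(* derivative of x |-> j^infty_x eta along x^a, at any eta with jet z.        *)
Definition hatd (a : 'I_n) (z : jet) : jet := fun c =>
  match c with
  | inl b => (b == a)%:R
  | inr (bc, C) => z (inr (bc, mi_incr C a))
  end.

Definition hor (z v : jet) : jet := \sum_a v (inl a) *: hatd a z.

Definition ver (z v : jet) : jet := v - hor z v.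

(* Component of vertical degree p and horizontal degree q. *)
Definition bipart (p q : nat) (w : jform) : jform := fun z s =>
  if size s == (p + q)%N then
    \sum_(m : (size s).-tuple bool | count id m == p)
       w z [seq (if bv.1 then ver z bv.2 else hor z bv.2) | bv <- zip m s]
  else 0.

(* Horizontal differential on forms of bidegree (p, q): on these, extd is the *)
(* sum of its components of bidegrees (p + 1, q) and (p, q + 1).              *)
Definition hd (p q : nat) (w : jform) : jform := bipart p q.+1 (extd w).

(* w is a form on J^infty Lor over U, of bidegree (p, q). Locally it is the   *)
(* pullback of a smooth form on some finite jet bundle J^k Lor.               *)
Record Omega (U : set 'rV[R]_n) (p q : nat) (w : jform) : Prop := MkOmega {
  Omega_linear : forall z s1 s2 (a : R) (u v : jet), JLor U z ->
    w z (s1 ++ (a *: u + v) :: s2) =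
    a * w z (s1 ++ u :: s2) + w z (s1 ++ v :: s2);
  Omega_alternating : forall z s1 s2 s3 (v : jet), JLor U z ->
    w z (s1 ++ v :: s2 ++ v :: s3) = 0;
  Omega_bidegree : forall z s, JLor U z -> bipart p q w z s = w z s;
  Omega_finite_order : forall z0, JLor U z0 ->
    exists (k : nat) (O : set jet), [/\ open O, O z0 &
      forall y z s t, JLor U y -> JLor U z -> O y -> O z ->
        agree_upto k y z -> size s = size t ->
        (forall i, agree_upto k (nth 0 s i) (nth 0 t i)) ->
        w y s = w z t];
  Omega_smooth : forall s, smooth_on (JLor U) (fun z => w z s)
}.

Definition dx (a : 'I_n) : jform := extd (fun_form (xco a)).

Definition vol : jform :=
  fscale (fun z => Num.sqrt (- \det (gmx z)))
         (\big[wedge/fun_form (fun=> 1)]_(a < n) dx a).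

Definition Gamma (a b c : 'I_n) (z : jet) : R :=
  2^-1 * \sum_d invmx (gmx z) a d *
     (gco d b (mi_incr (mi0 n) c) z + gco d c (mi_incr (mi0 n) b) z
      - gco b c (mi_incr (mi0 n) d) z).

Definition nabla (c : 'I_n) (chi : 'I_n -> jform) (a : 'I_n) : jform :=
  lieD (hatd c) (chi a) + \sum_b fscale (Gamma a c b) (chi b).

End Jets.

Arguments jform : clear implicits.

(* Main.v *)
Require Import Defs.
From mathcomp Require Import all_boot all_order all_algebra.
From mathcomp Require Import all_classical all_reals all_analysis.
From mathcomp Require Import perm zify ring lra.

(** The idea is to work with the densities sqrt(-det g) chi^a and the constant
    coordinate volume form D = dx^1 /\ ... /\ dx^n instead of chi^a and vol_g.

    Write q for sqrt(-det g) and X_a for the horizontal lift of d/dx^a. Since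
    vol_g = q D, the form to be differentiated is the sum of the products
    (q chi^a) /\ i_(X_a) D. Its second factor is horizontal with constant
    coefficients, so the Leibniz rule ([extd_wedgef]) gives the sum of the products
    alpha_a /\ i_(X_a) D, where alpha_a is the total differential of q chi^a.

    The rest is linear algebra at one jet. As alpha_a /\ D vanishes on p vertical
    and n + 1 horizontal vectors, contracting it with X_a shows that the part of
    bidegree (p, n) of alpha_a /\ i_(X_a) D is (-1)^p (i_(X_a) alpha_a) /\ D
    ([split_contraction]). Moreover chi^a is annihilated by the X_b, whence
    i_(X_a) alpha_a = q L_(X_a) chi^a + (X_a q) chi^a ([extd_density_hatd]).
    Finally Jacobi's formula for the derivative of a determinant yields
    X_b q = q Gamma^a_(ab) ([dird_sqrt_det_hatd]), and the sum over a is q times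
    the divergence of chi.

    Two analytic facts support this. The exterior derivative of an alternating
    form is multilinear only if directional derivatives are additive in the
    direction, which for functions on the infinite-dimensional space of jets is
    derived from the continuity of these derivatives ([Ck1_gdiff]). And identities
    between forms are given on lorentzian jets only, so differentiating them
    requires that these jets form an open set ([JLor_open]); this is the stability
    of the signature of a symmetric matrix ([congruence_open]).

    Throughout, products and exterior derivatives are handled by recursion on the
    list of arguments ([wedgef_cons], [extd_cons]). *)

Set Implicit Arguments.
Unset Strict Implicit.
Unset Printing Implicit Defensive.

Import Order.TTheory GRing.Theory Num.Theory.
Import numFieldNormedType.Exports.

Local Open Scope classical_set_scope.
Local Open Scope ring_scope.

(** * Alternating multilinear forms on a vector space *)

Lemma big_tuple_cons (R : nmodType) (I : finType) (k : nat)
    (P : pred (seq I)) (F : seq I -> R) :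
  \sum_(m : k.+1.-tuple I | P m) F m =
  \sum_(b : I) \sum_(m : k.-tuple I | P (b :: m)) F (b :: m).
Proof.
rewrite (reindex (fun bm : I * k.-tuple I => [tuple of bm.1 :: bm.2])) /=.
  by rewrite pair_big_dep /=.
exists (fun m : k.+1.-tuple I => (thead m, [tuple of behead m])).
  by move=> [b m] _ /=; congr pair; apply/val_inj.
by move=> m _ /=; rewrite [RHS]tuple_eta; apply/val_inj.
Qed.

Lemma not_uniqP (T : eqType) (s : seq T) : ~~ uniq s ->
  exists x s1 s2 s3, s = s1 ++ x :: s2 ++ x :: s3.
Proof.
elim: s => //= x s IH; rewrite negb_and negbK => /orP[/splitPr[s2 s3]|/IH].
  by exists x, [::], s2, s3.
by move=> [y [s1 [s2 [s3 ->]]]]; exists y, (x :: s1), s2, s3.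
Qed.

Section PointwiseForms.
Context {R : realFieldType} {V : lmodType R}.
Implicit Types (f g : seq V -> R) (s t : seq V).

Definition contract (x : V) f : seq V -> R := fun s => f (x :: s).
(** The sign carried by a vector that moves past all the arguments of f *)
Definition gradeinv f : seq V -> R := fun s => (-1) ^+ size s * f s.
(** The same shuffle sum as the exterior product of two forms, at a single
    point: [wedge u w z] is convertible to [wedgef (u z) (w z)]. *)
Definition wedgef f g : seq V -> R := fun s =>
  \sum_(m : (size s).-tuple bool)
     (-1) ^+ mask_inv m * f (mask m s) * g (mask (map negb m) s).

Lemma wedgef_nil f g : wedgef f g [::] = f [::] * g [::].
Proof.
rewrite /wedgef /= (big_pred1 [tuple]) => [|m]; first by rewrite /= expr0 mul1r.
by apply/esym/eqP; exact: tuple0.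
Qed.

(** The antiderivation rule of the interior product: the mask sends x either to
    the first factor or to the second one, and then x has to move past the
    arguments of the first. Inductions on the list of arguments use this rule
    in place of the signs of shuffles. *)
Lemma wedgef_cons f g x s : wedgef f g (x :: s) =
  wedgef (contract x f) g s + wedgef (gradeinv f) (contract x g) s.
Proof.
rewrite /wedgef /= (@big_tuple_cons _ _ _ predT
  (fun m : seq bool => (-1) ^+ mask_inv m *
   f (mask m (x :: s)) * g (mask (map negb m) (x :: s)))) big_bool /=.
congr (_ + _); apply: eq_bigr => m _ //.
by rewrite /gradeinv /contract exprD size_mask ?size_tuple //; ring.
Qed.

Lemma eq_wedgef f f' g g' s : (forall r, f r = f' r) -> (forall r, g r = g' r) ->
  wedgef f g s = wedgef f' g' s.
Proof. by move=> ff' gg'; apply: eq_bigr => m _; rewrite ff' gg'. Qed.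

Lemma wedgef_lin2 f1 f2 (a b : R) g s :
  wedgef (fun r => a * f1 r + b * f2 r) g s =
  a * wedgef f1 g s + b * wedgef f2 g s.
Proof.
rewrite /wedgef !mulr_sumr -big_split /=; apply: eq_bigr => m _; ring.
Qed.

Lemma wedgef_lin2r f g1 g2 (a b : R) s :
  wedgef f (fun r => a * g1 r + b * g2 r) s =
  a * wedgef f g1 s + b * wedgef f g2 s.
Proof.
rewrite /wedgef !mulr_sumr -big_split /=; apply: eq_bigr => m _; ring.
Qed.

Lemma wedgef_Zl (a : R) f g s :
  wedgef (fun r => a * f r) g s = a * wedgef f g s.
Proof. by rewrite /wedgef mulr_sumr; apply: eq_bigr => m _; ring. Qed.

Lemma wedgef_Zr (a : R) f g s :
  wedgef f (fun r => a * g r) s = a * wedgef f g s.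
Proof. by rewrite /wedgef mulr_sumr; apply: eq_bigr => m _; ring. Qed.

Lemma wedgef_suml (I : finType) (f : I -> seq V -> R) g s :
  wedgef (fun r => \sum_i f i r) g s = \sum_i wedgef (f i) g s.
Proof.
rewrite /wedgef exchange_big /=; apply: eq_bigr => m _.
by rewrite mulr_sumr mulr_suml.
Qed.

Lemma wedgef_degree p q f g s :
  (forall r, size r != p -> f r = 0) -> (forall r, size r != q -> g r = 0) ->
  size s != (p + q)%N -> wedgef f g s = 0.
Proof.
move=> fp gq hs; apply: big1 => m _.
have [hp|/fp ->] := eqVneq (size (mask m s)) p; last by rewrite mulr0 mul0r.
rewrite gq ?mulr0 // size_mask ?size_map ?size_tuple // count_map.
move: hs; apply: contra => /eqP <-; rewrite -hp size_mask ?size_tuple //.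
rewrite (@eq_count _ (preim negb id) (predC id)) //.
by rewrite count_predC size_tuple.
Qed.

(** Alternation is required for neighbours only, because that condition is
    stable under the recursions on the list of arguments; [altlin_dup] recovers
    the general one. *)
Definition altlin f : Prop :=
  (forall s1 s2 a u v,
     f (s1 ++ (a *: u + v) :: s2) = a * f (s1 ++ u :: s2) + f (s1 ++ v :: s2)) /\
  (forall s1 s2 u v, f (s1 ++ u :: v :: s2) = - f (s1 ++ v :: u :: s2)).

Lemma altlin_ins x f : altlin f -> altlin (contract x f).
Proof.
move=> [fl fa]; split=> s1 s2.
  by move=> a u v; exact: (fl (x :: s1)).
by move=> u v; exact: (fa (x :: s1)).
Qed.

Lemma altlin_grade f : altlin f -> altlin (gradeinv f).
Proof.
move=> [fl fa]; split=> s1 s2.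
  by move=> a u v; rewrite /gradeinv fl !size_cat /=; ring.
by move=> u v; rewrite /gradeinv fa !size_cat /=; ring.
Qed.

Lemma altlin_scale (c : R) f : altlin f -> altlin (fun s => c * f s).
Proof.
move=> [fl fa]; split=> s1 s2.
  by move=> a u v; rewrite fl; ring.
by move=> u v; rewrite fa; ring.
Qed.

Lemma altlin_wedge f g : altlin f -> altlin g -> altlin (wedgef f g).
Proof.
move=> fA gA; split=> s1.
  elim: s1 f g fA gA => [|x s1 IH] f g fA gA s2 a u v; last first.
    rewrite !cat_cons !wedgef_cons !IH ?mulrDr; try exact: altlin_ins;
      try exact: altlin_grade; try by [].
    by ring.
  rewrite !cat0s !wedgef_cons.
  rewrite (@eq_wedgef _ (fun r => a * contract u f r + 1 * contract v f r) g g) //; last first.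
    by move=> r; rewrite mul1r; exact: (fA.1 [::]).
  rewrite (@eq_wedgef (gradeinv f) (gradeinv f) _
             (fun r => a * contract u g r + 1 * contract v g r)) //; last first.
    by move=> r; rewrite mul1r; exact: (gA.1 [::]).
  by rewrite wedgef_lin2 wedgef_lin2r; ring.
elim: s1 f g fA gA => [|x s1 IH] f g fA gA s2 u v; last first.
  rewrite !cat_cons !wedgef_cons opprD; congr (_ + _); apply: IH => //;
    by [exact: altlin_ins|exact: altlin_grade].
rewrite !cat0s !wedgef_cons.
rewrite (@eq_wedgef (contract v (contract u f))
  (fun r => -1 * contract u (contract v f) r) g g) //;
  last by move=> r; rewrite mulN1r; exact: (fA.2 [::]).
rewrite (@eq_wedgef (gradeinv (gradeinv f)) (gradeinv (gradeinv f))
   (contract v (contract u g)) (fun r => -1 * contract u (contract v g) r)) //;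
  last by move=> r; rewrite mulN1r; exact: (gA.2 [::]).
(* the two mixed terms are exchanged, since contraction and grading anticommute *)
have gi w h k r : wedgef (gradeinv (contract w h)) k r =
                  - wedgef (contract w (gradeinv h)) k r.
  rewrite -mulN1r -wedgef_Zl; apply: eq_wedgef => // r'.
  by rewrite /gradeinv /contract /= exprS; ring.
by rewrite wedgef_Zl wedgef_Zr !gi; ring.
Qed.

Lemma altlin_move f s0 s1 s2 x : altlin f ->
  f (s0 ++ s1 ++ x :: s2) = (-1) ^+ size s1 * f (s0 ++ x :: s1 ++ s2).
Proof.
move=> fA; elim: s1 s0 => [|y s1 IH] s0 /=; first by rewrite mul1r.
have := IH (rcons s0 y); rewrite !cat_rcons => ->.
by rewrite fA.2 exprS; ring.
Qed.

Lemma altlin_dup f s1 s2 s3 x : altlin f -> f (s1 ++ x :: s2 ++ x :: s3) = 0.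
Proof.
move=> fA; have := @altlin_move f (rcons s1 x) s2 s3 x fA.
rewrite !cat_rcons => ->.
suff -> : f (s1 ++ x :: x :: s2 ++ s3) = 0 by rewrite mulr0.
by have := fA.2 s1 (s2 ++ s3) x x; lra.
Qed.

Lemma altlin0 f s1 s2 : altlin f -> f (s1 ++ 0 :: s2) = 0.
Proof. by move=> fA; have := fA.1 s1 s2 1 0 0; rewrite scaler0 addr0; lra. Qed.

Lemma altlin_sum f (I : finType) (c : I -> R) (X : I -> V) s1 s2 : altlin f ->
  f (s1 ++ (\sum_i c i *: X i) :: s2) = \sum_i c i * f (s1 ++ X i :: s2).
Proof.
move=> fA; apply: (big_ind2 (fun x y => f (s1 ++ x :: s2) = y)).
- exact: altlin0.
- by move=> x1 y1 x2 y2 <- <-; have := fA.1 s1 s2 1 x1 x2; rewrite scale1r mul1r.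
- by move=> i _; have := fA.1 s1 s2 (c i) (X i) 0; rewrite addr0 altlin0 // addr0.
Qed.

(** Expanding these entries over the n vectors X leaves terms in which two of the
    arguments are the same X i. Each entry that has been expanded is moved to the
    front, where the indices bs of the chosen vectors are collected. *)
Lemma altlin_span f (n : nat) (X : 'I_n -> V) (h : pred V) s : altlin f ->
  (forall v, h v -> exists c : 'I_n -> R, v = \sum_i c i *: X i) ->
  (n < count h s)%N -> f s = 0.
Proof.
move=> fA hX; suff: forall t vs (bs : seq 'I_n), (n < size bs + count h t)%N ->
    f (map X bs ++ vs ++ t) = 0 by move=> /(_ s [::] [::]).
elim=> [|v t IH] vs bs /=.
  rewrite addn0 => hb.
  have /not_uniqP[b [s1 [s2 [s3 ->]]]] : ~~ uniq bs.
    apply/negP => /card_uniqP bu; move: hb; rewrite ltnNge -bu.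
    by rewrite -[X in (_ <= X)%N](card_ord n) max_card.
  by rewrite map_cat /= map_cat /= -!catA /= -catA /=; exact: altlin_dup.
case: (boolP (h v)) => [/hX[c ->] hb|_ hb]; last first.
  by rewrite -cat_rcons; exact: IH.
rewrite altlin_move //; apply/eqP; rewrite mulf_eq0; apply/orP; right.
rewrite altlin_sum // big1 // => b _.
have := @altlin_move f [::] (map X bs) (vs ++ t) (X b) fA.
rewrite !cat0s => ->.
by rewrite (IH vs (b :: bs)) ?mulr0 //= addSn -addnS.
Qed.

(** For a form on the jet space and the predicate of being vertical, this is
    horizontality. *)
Definition kills (h : pred V) f : Prop :=
  forall s1 s2 v, h v -> f (s1 ++ v :: s2) = 0.

Lemma wedgef0r f g s : (forall r, g r = 0) -> wedgef f g s = 0.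
Proof. by move=> g0; apply: big1 => m _; rewrite g0 mulr0. Qed.

Lemma wedgef0l f g s : (forall r, f r = 0) -> wedgef f g s = 0.
Proof. by move=> f0; apply: big1 => m _; rewrite f0 mulr0 mul0r. Qed.

Lemma kills_wedge h f g : kills h f -> kills h g -> kills h (wedgef f g).
Proof.
move=> fh gh s1; elim: s1 f g fh gh => [|x s1 IH] f g fh gh s2 v hv /=.
  rewrite wedgef_cons wedgef0l ?wedgef0r ?addr0 // => r; rewrite /contract.
    exact: (gh [::]).
  exact: (fh [::]).
rewrite wedgef_cons !IH ?addr0 //.
- by move=> t1 t2 w hw; rewrite /gradeinv fh ?mulr0.
- by move=> t1 t2; exact: (gh (x :: t1)).
- by move=> t1 t2; exact: (fh (x :: t1)).
Qed.

(** The factor f can absorb fewer than q arguments, so that one which g kills is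
    left over for g. *)
Lemma wedgef_many_killed h f g (q : nat) s :
  (forall r, (q <= size r)%N -> f r = 0) -> kills h g ->
  (q <= count h s)%N -> wedgef f g s = 0.
Proof.
elim: s f g q => [|v s IH] f g q fq gh /= hq.
  by rewrite wedgef_nil fq ?mul0r.
rewrite wedgef_cons (IH _ _ q.-1) //; last 2 first.
- by move=> r hr; apply: fq => /=; rewrite -ltnS in hr; exact: leq_trans (leqSpred _) hr.
- by case: (h v) hq => /=; lia.
rewrite add0r; case: (boolP (h v)) => [hv|nhv].
  by apply: wedgef0r => r; exact: (gh [::]).
rewrite (IH _ _ q) //.
- by move=> r hr; rewrite /gradeinv fq ?mulr0.
- by move=> t1 t2; exact: (gh (v :: t1)).
- by rewrite (negbTE nhv) add0n in hq.
Qed.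

Section Splitting.
Variables (ve ho : V -> V).
Hypothesis veho : forall v, v = ve v + ho v.

Definition splitseq (m : seq bool) s :=
  [seq (if bv.1 then ve bv.2 else ho bv.2) | bv <- zip m s].

(** Choosing the masks with p entries equal to [true] in this sum is the
    projection to vertical degree p. *)
Lemma altlin_split f s : altlin f ->
  f s = \sum_(m : (size s).-tuple bool) f (splitseq m s).
Proof.
move=> fA; elim: s f fA => [|v s IH] f fA /=.
  by rewrite (big_pred1 [tuple]) // => m; apply/esym/eqP; exact: tuple0.
rewrite (@big_tuple_cons _ _ _ predT (fun m => f (splitseq m (v :: s)))).
rewrite big_bool /=.
have := fA.1 [::] s 1 (ve v) (ho v).
rewrite /= scale1r mul1r -veho => ->.
by congr (_ + _);
  [rewrite -[LHS]/(contract (ve v) f s)|rewrite -[LHS]/(contract (ho v) f s)];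
  rewrite IH //; exact: altlin_ins.
Qed.

Lemma count_splitseq_ve (h : pred V) m s : (forall v, h (ve v)) ->
  size m = size s -> (count id m <= count h (splitseq m s))%N.
Proof.
move=> hh; elim: m s => [|b m IH] [|v s] //= [ms].
by apply: leq_add; [case: b; rewrite ?hh|exact: IH].
Qed.

Lemma count_splitseq_ho (h : pred V) m s : (forall v, h (ho v)) ->
  size m = size s -> (size s - count id m <= count h (splitseq m s))%N.
Proof.
move=> hh; elim: m s => [|b m IH] [|v s] //= [ms].
have := IH s ms; have := count_size id m; rewrite ms /=.
case: b => hc hk; rewrite /= ?hh ?add1n ?add0n ?subSS ?subSn //.
exact: leq_trans hk (leq_addl _ _).
Qed.

(** The part of bidegree (p, n) of alpha /\ i_X D is, up to sign, the product
    i_X alpha /\ D; here h is the predicate of being vertical, alpha has degree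
    p + 1 and D is horizontal. The antiderivation rule applied to alpha /\ D gives

      i_X (alpha /\ D) = i_X alpha /\ D + (-1)^(p+1) alpha /\ i_X D,

    and the left-hand side vanishes on p vertical and n horizontal vectors,
    because together with X there are n + 1 horizontal ones. The form
    i_X alpha /\ D is already of bidegree (p, n): more than p vertical vectors
    force one of them into D, more than n horizontal ones are dependent. *)
Lemma split_contraction (n p : nat) (X : 'I_n -> V) (h : pred V) alpha D a s :
  altlin alpha -> altlin D -> kills h D -> (forall v, h (ve v)) ->
  (forall r, size r != p.+1 -> alpha r = 0) ->
  (forall v, exists c : 'I_n -> R, ho v = \sum_i c i *: X i) ->
  size s = (p + n)%N ->
  \sum_(m : (size s).-tuple bool | count id m == p)
     wedgef alpha (contract (X a) D) (splitseq m s) =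
  (-1) ^+ p * wedgef (contract (X a) alpha) D s.
Proof.
move=> aA DA Dh hve adeg hoX ss.
pose k : pred V := fun v => `[< exists c : 'I_n -> R, v = \sum_i c i *: X i >].
have kX v : k v -> exists c : 'I_n -> R, v = \sum_i c i *: X i by move/asboolP.
have kho v : k (ho v) by apply/asboolP.
have kXa : k (X a).
  apply/asboolP; exists (fun i => (i == a)%:R).
  rewrite (bigD1 a) //= eqxx scale1r big1 ?addr0 // => i /negbTE ->.
  by rewrite scale0r.
have uA := altlin_ins (X a) aA.
have wA := altlin_wedge uA DA.
rewrite [in RHS](altlin_split s wA) mulr_sumr [RHS](bigID (fun m : (size s).-tuple bool =>
  count id m == p)) /= [X in _ = _ + X]big1 ?addr0; last first.
  move=> m; case: (ltngtP (count id m) p) => // [mp|pm] _.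
  - rewrite (altlin_span wA kX) ?mulr0 //.
    have := @count_splitseq_ho k m s kho; rewrite size_tuple => /(_ erefl).
    by lia.
  - rewrite (@wedgef_many_killed h _ _ p.+1) ?mulr0 //.
    + by move=> r hr; apply: adeg => /=; rewrite eqSS neq_ltn hr orbT.
    + by apply: leq_trans pm _; apply: count_splitseq_ve => //; rewrite size_tuple.
apply: eq_bigr => m /eqP mp.
have : wedgef alpha D (X a :: splitseq m s) = 0.
  apply: (altlin_span (altlin_wedge aA DA) kX) => /=; rewrite kXa.
  have := @count_splitseq_ho k m s kho; rewrite size_tuple => /(_ erefl).
  by lia.
rewrite wedgef_cons (@eq_wedgef (gradeinv alpha) (fun r => (-1) ^+ p.+1 * alpha r)
  (contract (X a) D) (contract (X a) D)) //; last first.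
  move=> r; rewrite /gradeinv; have [->//|/adeg ->] := eqVneq (size r) p.+1.
  by rewrite !mulr0.
rewrite wedgef_Zl => /eqP; rewrite addr_eq0 => /eqP ->.
rewrite (exprS _ p); have := sqrr_sign R p; move: ((-1) ^+ p) => e e2.
by rewrite mulrN mulrA mulN1r mulrN mulNr opprK -expr2 e2 mul1r.
Qed.
End Splitting.
End PointwiseForms.

(** * Directional derivatives on the space of jets *)

Section JetCalculus.
Context {R : realType} {n : nat}.
Local Notation jet := (jet R n).
Implicit Types (f g : jet -> R) (z u v : jet).

Lemma jet_cvg (T : Type) (F : set_system T) (g : T -> jet) (z : jet) :
  Filter F -> (forall c, (fun t => g t c) @ F --> z c) -> g @ F --> z.
Proof.
move=> FF h; apply/cvg_sup => c; apply/cvg_image.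
  by rewrite eqEsubset; split=> v // _; exists (cst v).
move=> W /(h c) Wg; exists ((fun z : jet => z c) @^-1` W) => //.
rewrite eqEsubset; split => [j [y Wy <-]//|j Wj]; by exists (fun=> j).
Qed.

Lemma jet_coord_continuous (c : jcoord n) : continuous (fun z : jet => z c).
Proof. by move=> z; exact: (@proj_continuous (jcoord n) (fun=> R) c z). Qed.

(** Along two directions at once, since the mean value theorem below evaluates a
    derivative at an unknown point of the plane through z. *)
Lemma jet_plane_cvg z u v :
  (fun tc : R * R => z + tc.1 *: u + tc.2 *: v) @ nbhs (0 : R, 0 : R) --> z.
Proof.
apply: jet_cvg => c.
have -> : z c = z c + 0 * u c + 0 * v c by rewrite !mul0r !addr0.
apply: (@cvgD _ _ _ _ _ (fun tc : R * R => z c + tc.1 * u c)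
  (fun tc : R * R => tc.2 * v c)).
  apply: (@cvgD _ _ _ _ _ (fun tc : R * R => z c) (fun tc : R * R => tc.1 * u c)).
    exact: cvg_cst.
  by apply: cvgM; [exact: cvg_fst|exact: cvg_cst].
by apply: cvgM; [exact: cvg_snd|exact: cvg_cst].
Qed.

Lemma jet_line_cvg z v : (fun t : R => z + t *: v) @ (0 : R) --> z.
Proof.
apply: jet_cvg => c; have -> : z c = z c + 0 * v c by rewrite !mul0r !addr0.
apply: (@cvgD _ _ _ _ _ (fun t : R => z c) (fun t : R => t * v c)).
  exact: cvg_cst.
by apply: cvgM; [exact: cvg_id|exact: cvg_cst].
Qed.

Definition is_dird f z v (l : R) : Prop :=
  is_derive (0 : R) (1 : R) (along f v z) l.

Lemma is_dirdE f z v l : is_dird f z v l -> dird v f z = l.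
Proof. by move=> h; rewrite /dird derive1E; exact: (@derive_val _ _ _ _ _ _ _ h). Qed.

Lemma along0 f v z : along f v z 0 = f z.
Proof. by rewrite /along scale0r addr0. Qed.

(** Gateaux differentiability with a linear differential: all that is needed for
    the exterior derivative to be multilinear, on a space of jets that carries no
    norm *)
Definition gdiff f z : Prop :=
  (forall v, is_dird f z v (dird v f z)) /\
  (forall a u v, dird (a *: u + v) f z = a * dird u f z + dird v f z).

Lemma gdiffI f z (L : jet -> R) : (forall v, is_dird f z v (L v)) ->
  (forall a u v, L (a *: u + v) = a * L u + L v) -> gdiff f z.
Proof.
move=> fL Ll; have E v : dird v f z = L v by exact: is_dirdE.
by split=> [v|a u v]; rewrite !E.
Qed.

Lemma dird_near f g z v : (\forall y \near z, f y = g y) ->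
  dird v f z = dird v g z.
Proof.
move=> fg; rewrite /dird !derive1E; apply: near_eq_derive.
by have /(_ _ fg) := @jet_line_cvg z v.
Qed.

Lemma is_dirdM f g z v a b : is_dird f z v a -> is_dird g z v b ->
  is_dird (fun y => f y * g y) z v (f z * b + g z * a).
Proof.
move=> fa gb; have := @is_deriveM _ _ _ _ _ _ _ _ fa gb.
by rewrite !along0.
Qed.

Lemma is_dirdD f g z v a b : is_dird f z v a -> is_dird g z v b ->
  is_dird (fun y => f y + g y) z v (a + b).
Proof. by move=> fa gb; exact: (@is_deriveD _ _ _ _ _ _ _ _ _ fa gb). Qed.

Lemma is_dird_cst (c : R) z v : is_dird (fun=> c) z v 0.
Proof. exact: is_derive_cst. Qed.

Lemma is_dirdZ f z v (c a : R) : is_dird f z v a ->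
  is_dird (fun y => c * f y) z v (c * a).
Proof.
move=> fa; have := is_dirdM (is_dird_cst c z v) fa.
by rewrite mulr0 addr0.
Qed.

Lemma is_dird_sum (I : Type) (r : seq I) (P : pred I) (F : I -> jet -> R)
    (a : I -> R) z v :
  (forall i, is_dird (F i) z v (a i)) ->
  is_dird (fun y => \sum_(i <- r | P i) F i y) z v (\sum_(i <- r | P i) a i).
Proof.
move=> Fa; elim: r => [|i r IH].
  by rewrite big_nil; under [X in is_dird X]funext do rewrite big_nil;
     exact: is_dird_cst.
rewrite big_cons; under [X in is_dird X]funext do rewrite big_cons.
by case: (P i) => //; exact: is_dirdD.
Qed.

Lemma gdiffM f g z : gdiff f z -> gdiff g z -> gdiff (fun y => f y * g y) z.
Proof.
move=> [fd fl] [gd gl].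
apply: (gdiffI (L := fun v => f z * dird v g z + g z * dird v f z)).
  by move=> v; exact: is_dirdM.
by move=> a u v; rewrite fl gl; ring.
Qed.

Lemma Ck1_is_dird O f z v : Ck 1 O f -> O z -> is_dird f z v (dird v f z).
Proof.
move=> [_ /(_ v)[fd _]] Oz; rewrite /dird derive1E.
exact/derivableP/fd.
Qed.

Lemma is_dird_scale f z u (a l : R) : is_dird f z u l ->
  is_dird f z (a *: u) (a * l).
Proof.
move=> fu; rewrite /is_dird.
have -> : along f (a *: u) z = along f u z \o ( *%R a).
  by apply/funext => t; rewrite /along /= scalerA mulrC.
rewrite mulrC; apply: is_derive1_comp; first by rewrite mulr0.
have := @is_deriveZ _ _ _ (id : R -> R) a (0 : R) 1 1 (is_derive_id _ _).
by rewrite /GRing.scale /= mulr1.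
Qed.

Lemma is_dird_shift f z v (s l : R) : is_dird f (z + s *: v) v l ->
  is_derive s 1 (along f v z) l.
Proof.
move=> fu.
have -> : along f v z = along f v (z + s *: v) \o (fun x => x + - s).
  apply/funext => t; rewrite /along /=; congr f.
  by rewrite -addrA -scalerDl addrCA subrr addr0.
rewrite -[l]mulr1; apply: is_derive1_comp; first by rewrite subrr.
exact: is_derive_shift.
Qed.

(** Going first along u and then along v, the mean value theorem turns the second
    step into t times a value of [dird v f] near z, which tends to [dird v f z] by
    continuity. One-sided limits suffice because the derivatives exist. *)
Lemma Ck1_dirdD O f z u v : open O -> O z -> Ck 1 O f ->
  dird (u + v) f z = dird u f z + dird v f z.
Proof.
move=> oO Oz C1f.
have dc : {for z, continuous (dird v f)}.
  by have [_ /(_ v)[_ [/(_ z Oz)]]] := C1f.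
have quot w : (fun h => h^-1 *: (f (z + h *: w) - f z)) @ (0 : R)^'+ --> dird w f z.
  have [wd wE] := Ck1_is_dird w C1f Oz.
  apply: cvg_dnbhs_at_right; rewrite -wE; apply: cvg_trans wd.
  apply: near_eq_cvg; near=> h.
  by rewrite /along /= !addr0 scale0r addr0 [h *: 1]mulr1.
set A := dird (u + v) f z; set B := dird u f z; set C := dird v f z.
suff : `|A - B - C| <= 0.
  by rewrite normr_le0 subr_eq0 subr_eq => /eqP ->; rewrite addrC.
apply/ler_addgt0Pr => e e0; rewrite add0r.
have e3 : 0 < e / 3 by rewrite divr_gt0.
have /cvgrPdist_lt/(_ _ e3) /= Cnear := dc.
have : \forall tc \near (0 : R, 0 : R),
    O (z + tc.1 *: u + tc.2 *: v) /\
    `|C - dird v f (z + tc.1 *: u + tc.2 *: v)| < e / 3.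
  have /(_ [set y | O y /\ `|C - dird v f y| < e / 3]) := @jet_plane_cvg z u v.
  by apply; apply: filterI => //; exact: open_nbhs_nbhs.
move=> [[/= P Q] [nP nQ] PQ].
have : \forall t \near (0 : R)^'+, [/\ 0 < t, forall c, `|c| <= t -> P c /\ Q c,
    `|A - t^-1 *: (f (z + t *: (u + v)) - f z)| < e / 3 &
    `|B - t^-1 *: (f (z + t *: u) - f z)| < e / 3].
  near=> t; split.
  - by near: t; exact: nbhs_right_gt.
  - near: t; have /nbhsr0P : \forall c \near (0 : R), P c /\ Q c by apply: filterI.
    by apply: filterS => t h c ct; apply: h; rewrite sub0r normrN.
  - near: t; have /cvgrPdist_lt := quot (u + v); exact.
  - near: t; have /cvgrPdist_lt := quot u; exact.
move=> /filter_ex[t [t0 PQt quv qu]].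
have tn : `|t| <= t by rewrite gtr0_norm.
have good c : 0 <= c <= t -> O (z + t *: u + c *: v) /\
    `|C - dird v f (z + t *: u + c *: v)| < e / 3.
  move=> /andP[c0 ct]; apply: (PQ (t, c)); split=> /=.
    by have [] := PQt t tn.
  by have [] := PQt c; rewrite ?ger0_norm.
have dphi c : 0 <= c <= t ->
    is_derive c 1 (along f v (z + t *: u)) (dird v f (z + t *: u + c *: v)).
  by move=> /good[Oc _]; apply/is_dird_shift/(Ck1_is_dird _ C1f).
have [] := @MVT R (along f v (z + t *: u))
    (fun c => dird v f (z + t *: u + c *: v)) 0 t t0.
- move=> c; rewrite in_itv /= => /andP[c0 ct]; apply: dphi.
  by rewrite !ltW.
- apply: derivable_within_continuous => c; rewrite in_itv /= => ct.
  by have [] := dphi c ct.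
move=> c; rewrite in_itv /= => /andP[c0 ct].
have [|_ {}good] := good c; first by rewrite !ltW.
rewrite along0 /along subr0 => mvt.
have E : t^-1 *: (f (z + t *: (u + v)) - f z) =
    t^-1 *: (f (z + t *: u) - f z) + dird v f (z + t *: u + c *: v).
  rewrite [t *: (u + v)]scalerDr addrA.
  have -> : dird v f (z + t *: u + c *: v) =
    t^-1 *: (f (z + t *: u + t *: v) - f (z + t *: u)).
    by rewrite mvt /GRing.scale /= mulrCA mulVf ?mulr1 // gt_eqF.
  by rewrite -scalerDr; congr (_ *: _); ring.
move: quv qu good; rewrite E.
move: (t^-1 *: _) (dird v f _) => q d h1 h2 h3.
by move: h1 h2 h3; rewrite !ltr_norml ler_norml; lra.
Unshelve. all: by end_near.
Qed.

Lemma Ck1_gdiff O f z : open O -> O z -> Ck 1 O f -> gdiff f z.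
Proof.
move=> oO Oz C1f; split=> [v|a u v]; first exact: Ck1_is_dird C1f Oz.
rewrite (Ck1_dirdD _ _ oO Oz C1f); congr (_ + _).
exact/is_dirdE/is_dird_scale/(Ck1_is_dird _ C1f Oz).
Qed.

End JetCalculus.

(** * The exterior derivative *)

Section ExteriorDerivative.
Context {R : realType} {n : nat}.
Local Notation jet := (jet R n).
Local Notation jform := (jform R n).
Implicit Types (u w : jform) (z v : jet) (s : seq jet).
Local Notation ins x w := (iota_ (fun=> x) w).

Lemma extd_nil w z : extd w z [::] = 0.
Proof. by rewrite /extd big_ord0. Qed.

(** Cartan's formula for constant vector fields; it makes the exterior derivative
    recursive in its list of arguments, as [wedgef_cons] does for the product. *)
Lemma extd_cons w x z s :
  extd w z (x :: s) = dird x (w^~ s) z - extd (ins x w) z s.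
Proof.
rewrite /extd /= big_ord_recl /= expr0 mul1r drop0; congr (_ + _).
rewrite -sumrN; apply: eq_bigr => i _.
by rewrite /bump /= exprS mulN1r mulNr.
Qed.

Definition gdiffs w z : Prop := forall s, gdiff (w^~ s) z.

Lemma gdiffs_ins x w z : gdiffs w z -> gdiffs (ins x w) z.
Proof. by move=> h s; exact: (h (x :: s)). Qed.

Lemma extd_near w w' z s : (\forall y \near z, forall r, w y r = w' y r) ->
  extd w z s = extd w' z s.
Proof.
move=> ww'; apply: eq_bigr => i _; congr (_ * _); apply: dird_near.
by apply: filterS ww' => y; exact.
Qed.

Lemma eq_extd w w' z s : (forall y r, w y r = w' y r) ->
  extd w z s = extd w' z s.
Proof.
by move=> ww'; congr (extd _ z s); apply/funext => y; apply/funext => r.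
Qed.

Lemma extd_lin a b w1 w2 z s : gdiffs w1 z -> gdiffs w2 z ->
  extd (fun y r => a * w1 y r + b * w2 y r) z s =
  a * extd w1 z s + b * extd w2 z s.
Proof.
move=> g1 g2; rewrite /extd !mulr_sumr -big_split /=; apply: eq_bigr => i _.
set r := take i s ++ _.
rewrite (is_dirdE (is_dirdD (is_dirdZ a ((g1 r).1 _)) (is_dirdZ b ((g2 r).1 _)))).
by ring.
Qed.

Lemma extd_sum (I : Type) (r : seq I) (w : I -> jform) z s :
  (forall i, gdiffs (w i) z) ->
  extd (fun y t => \sum_(i <- r) w i y t) z s = \sum_(i <- r) extd (w i) z s.
Proof.
move=> gw; rewrite /extd exchange_big /=; apply: eq_bigr => i _.
by rewrite (is_dirdE (is_dird_sum _ _ (fun j => (gw j _).1 _))) mulr_sumr.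
Qed.

Lemma extd_degree w (p : nat) z s :
  (\forall y \near z, forall r, size r != p -> w y r = 0) ->
  size s != p.+1 -> extd w z s = 0.
Proof.
move=> wp sp; apply: big1 => i _.
have si : size (take i s ++ drop i.+1 s) != p.
  rewrite size_cat size_take size_drop ltn_ord; apply: contra sp => /eqP <-.
  by apply/eqP; have := ltn_ord i; lia.
rewrite (@dird_near _ _ _ (fun=> 0)) ?(is_dirdE (is_dird_cst _ _ _)) ?mulr0 //.
by apply: filterS wp => y; exact.
Qed.

(** Sufficient for [extd w] to be alternating and multilinear at z. Only the
    behaviour near z can be used, forms being meaningful on the lorentzian jets
    alone. *)
Definition regular w z : Prop :=
  gdiffs w z /\ \forall y \near z, altlin (w y).

Lemma regular_ins x w z : regular w z -> regular (ins x w) z.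
Proof.
move=> [gw aw]; split; first exact: gdiffs_ins.
by apply: filterS aw => y; exact: altlin_ins.
Qed.

Lemma extd_altlin w z : regular w z -> altlin (extd w z).
Proof.
have lin s1 : forall w, regular w z -> forall s2 a (u v : jet),
    extd w z (s1 ++ (a *: u + v) :: s2) =
    a * extd w z (s1 ++ u :: s2) + extd w z (s1 ++ v :: s2).
  elim: s1 => [|x s1 IH] {}w wR s2 a u v; rewrite /= !extd_cons; have [gw aw] := wR.
    rewrite (gw s2).2.
    have -> : extd (ins (a *: u + v) w) z s2 =
              a * extd (ins u w) z s2 + 1 * extd (ins v w) z s2.
      rewrite -extd_lin; [|exact: gdiffs_ins..].
      apply: extd_near; apply: filterS aw => y aw r.
      by rewrite /iota_ mul1r (aw.1 [::]).
    by ring.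
  rewrite (IH _ (regular_ins x wR)).
  have -> : dird x (w^~ (s1 ++ (a *: u + v) :: s2)) z =
      a * dird x (w^~ (s1 ++ u :: s2)) z + 1 * dird x (w^~ (s1 ++ v :: s2)) z.
    rewrite -(is_dirdE (is_dirdD (is_dirdZ a ((gw _).1 x)) (is_dirdZ 1 ((gw _).1 x)))).
    by apply: dird_near; apply: filterS aw => y aw; rewrite mul1r aw.1.
  by ring.
move=> wR; split=> s1; first by move=> s2 a u v; exact: lin.
elim: s1 w wR => [|x s1 IH] w wR s2 u v; rewrite /= !extd_cons; have [gw aw] := wR.
  have -> : extd (ins v (ins u w)) z s2 = -1 * extd (ins u (ins v w)) z s2 +
      0 * extd (ins u (ins v w)) z s2.
    rewrite -extd_lin; [|by do 2 apply: gdiffs_ins..].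
    apply: extd_near; apply: filterS aw => y aw r.
    by rewrite /iota_ mul0r addr0 mulN1r (aw.2 [::]).
  by rewrite /iota_; ring.
rewrite (IH _ (regular_ins x wR)).
have -> : dird x (w^~ (s1 ++ u :: v :: s2)) z =
    -1 * dird x (w^~ (s1 ++ v :: u :: s2)) z.
  rewrite -(is_dirdE (is_dirdZ (-1) ((gw _).1 x))).
  by apply: dird_near; apply: filterS aw => y aw; rewrite mulN1r aw.2.
by ring.
Qed.

Lemma is_dird_wedgef u (c : seq jet -> R) z v s : gdiffs u z ->
  is_dird (fun y => wedgef (u y) c s) z v
          (wedgef (fun r => dird v (u^~ r) z) c s).
Proof.
move=> gu; rewrite /wedgef.
pose F (m : (size s).-tuple bool) (y : jet) :=
  ((-1) ^+ mask_inv m * c (mask (map negb m) s)) * u y (mask m s).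
have := @is_dird_sum _ _ _ (index_enum _) xpredT F _ z v
  (fun m => is_dirdZ _ ((gu (mask m s)).1 v)).
rewrite /F; under eq_bigr do rewrite mulrAC.
by under [X in is_dird X]funext do under eq_bigr do rewrite mulrAC.
Qed.

Lemma gdiffs_wedgef u (c : seq jet -> R) z : gdiffs u z ->
  gdiffs (fun y => wedgef (u y) c) z.
Proof.
move=> gu s; apply: (gdiffI (fun v => is_dird_wedgef c v s gu)) => a v v' /=.
rewrite (@eq_wedgef _ _ _
  (fun r => a * dird v (u^~ r) z + 1 * dird v' (u^~ r) z) c c) //.
  by rewrite wedgef_lin2 mul1r.
by move=> r; rewrite (gu r).2 mul1r.
Qed.

(** The Leibniz rule, without a second term because c does not vary from point to
    point. *)
Lemma extd_wedgef u (c : seq jet -> R) z s : gdiffs u z ->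
  extd (fun y => wedgef (u y) c) z s = wedgef (extd u z) c s.
Proof.
elim: s u c => [|x s IH] u c gu.
  by rewrite extd_nil wedgef_nil extd_nil mul0r.
have gg : gdiffs (fun y => gradeinv (u y)) z.
  move=> r; rewrite /gradeinv.
  apply: (gdiffI (L := fun v => (-1) ^+ size r * dird v (u^~ r) z)).
    by move=> v; apply: is_dirdZ; exact: (gu r).1.
  by move=> a v v'; rewrite (gu r).2; ring.
rewrite extd_cons wedgef_cons (is_dirdE (is_dird_wedgef _ _ _ gu)).
have -> : extd (ins x (fun y => wedgef (u y) c)) z s =
    1 * extd (fun y => wedgef (contract x (u y)) c) z s +
    1 * extd (fun y => wedgef (gradeinv (u y)) (contract x c)) z s.
  rewrite -extd_lin.
  - by apply: eq_extd => y r; rewrite /iota_ wedgef_cons !mul1r.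
  - exact: gdiffs_wedgef (gdiffs_ins x gu).
  - exact: gdiffs_wedgef gg.
rewrite (IH _ _ (gdiffs_ins x gu)) (IH _ _ gg).
rewrite (@eq_wedgef _ _ (contract x (extd u z))
  (fun r => 1 * dird x (u^~ r) z + -1 * extd (ins x u) z r) c c) //;
  last by move=> r; rewrite /contract extd_cons mul1r mulN1r.
rewrite (@eq_wedgef _ _ (gradeinv (extd u z))
  (fun r => -1 * extd (fun y => gradeinv (u y)) z r) (contract x c) (contract x c)) //; last first.
  move=> r; rewrite /gradeinv /extd !mulr_sumr; apply: eq_bigr => i _.
  rewrite (is_dirdE (is_dirdZ _ ((gu _).1 _))) size_cat size_take size_drop ltn_ord.
  have E : (i + (size r - i.+1)).+1 = size r.
    by rewrite -addnS -subSn // subSS subnKC // ltnW.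
  by rewrite -[X in (-1) ^+ X * (_ * _)]E (exprS _ (_ + _)); ring.
by rewrite wedgef_lin2 wedgef_Zl; ring.
Qed.

End ExteriorDerivative.

(** * The metric and its volume density *)

(** Elimination of the first row and column by a congruence *)
Lemma block_pivot (R : fieldType) (n : nat) (a : R) (b : 'rV[R]_n)
    (C : 'M[R]_n) (P := block_mx 1%:M (- (a^-1 *: b)) 0 1%:M) : a != 0 ->
  P^T *m block_mx a%:M b b^T C *m P =
  block_mx a%:M 0 0 (C - a^-1 *: (b^T *m b)).
Proof.
move=> a0; rewrite /P tr_block_mx !mulmx_block !trmx1 !trmx0.
rewrite !mul1mx !mulmx1 !mul0mx !mulmx0 !addr0.
have -> : a%:M *m - (a^-1 *: b) + b = 0.
  by rewrite mul_scalar_mx scalerN scalerA mulfV // scale1r addNr.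
have -> : (- (a^-1 *: b))^T = - (a^-1 *: b^T) by apply/matrixP => i j; rewrite !mxE.
have -> : - (a^-1 *: b^T) *m a%:M + b^T = 0.
  by rewrite mul_mx_scalar scalerN scalerA mulfV // scale1r addNr.
by rewrite mul0mx add0r mulNmx -scalemxAl addrC.
Qed.

Lemma block_diag_congruence (R : fieldType) (n : nat) (a c : R) (C Q : 'M[R]_n) :
  (block_mx c%:M 0 0 Q : 'M[R]_(1 + n))^T *m block_mx a%:M 0 0 C *m
    (block_mx c%:M 0 0 Q : 'M[R]_(1 + n)) =
  block_mx (c ^+ 2 * a)%:M 0 0 (Q^T *m C *m Q).
Proof.
rewrite tr_block_mx !trmx0 tr_scalar_mx !mulmx_block.
rewrite !(mul0mx, mulmx0, add0r, addr0) -!scalar_mxM; congr block_mx.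
by rewrite expr2 mulrAC.
Qed.

Lemma diag_block (R : fieldType) (n : nat) (d : 'rV[R]_(1 + n)) :
  diag_mx d = block_mx (d 0 0)%:M 0 0 (diag_mx (rsubmx d)).
Proof.
rewrite -[d in LHS]hsubmxK diag_mx_row; congr block_mx.
apply/matrixP => i j; rewrite !ord1 !mxE; congr (d _ _ *+ _).
by apply/val_inj.
Qed.

(** A symmetric matrix close to an invertible diagonal one is congruent to it. The
    pivot is close to the first diagonal entry, so a rescaling makes them equal,
    and the Schur complement is still close to the rest of the diagonal. A filter
    replaces explicit bounds, which would deteriorate at each induction step. *)
Lemma congruence_open (R : realType) (T : Type) (F : set_system T) :
  Filter F -> forall (n : nat) (d : 'rV[R]_n) (A : T -> 'M[R]_n),
  (forall i, d 0 i != 0) -> (forall t, (A t)^T = A t) ->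
  (forall i j, A t i j @[t --> F] --> diag_mx d i j) ->
  \forall t \near F, exists P : 'M[R]_n,
    P \in unitmx /\ P^T *m A t *m P = diag_mx d.
Proof.
move=> FF; elim=> [|n IH] d A d0 Asym Ad.
  apply: nearW => t; exists 1%:M; rewrite unitmx1; split=> //.
  by apply/matrixP => - [].
pose a t : R := A t 0 0.
pose b t : 'rV[R]_n := ursubmx (A t : 'M[R]_(1 + n)).
pose C t := drsubmx (A t : 'M[R]_(1 + n)) - (a t)^-1 *: ((b t)^T *m b t).
have Eb t : (A t : 'M[R]_(1 + n)) =
    block_mx (a t)%:M (b t) (b t)^T (drsubmx (A t : 'M[R]_(1 + n))).
  rewrite -[LHS](@submxK _ 1 n 1 n); congr block_mx.
    apply/matrixP => i j; rewrite !ord1 !mxE eqxx mulr1n /a.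
    by congr (A t _ _); apply/val_inj.
  by rewrite /b -{1}(Asym t) trmx_ursub.
have ad : a t @[t --> F] --> d 0 0.
  by have := Ad 0 0; rewrite mxE eqxx mulr1n.
have bd i j : b t i j @[t --> F] --> 0.
  have h := Ad (lshift n i) (rshift 1 j).
  have d_ij : diag_mx d (lshift n i) (rshift 1 j) = 0.
    by rewrite mxE; case: eqVneq => // /(congr1 val); rewrite ord1.
  rewrite d_ij in h.
  by apply: cvg_trans h; apply: near_eq_cvg; apply: nearW => t; rewrite !mxE.
have aVd : (a t)^-1 @[t --> F] --> (d 0 0)^-1 by apply: cvgV; rewrite ?d0.
have Cd i j : C t i j @[t --> F] --> diag_mx (rsubmx (d : 'rV[R]_(1 + n))) i j.
  have -> : diag_mx (rsubmx (d : 'rV[R]_(1 + n))) i j =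
      diag_mx d (rshift 1 i) (rshift 1 j) - (d 0 0)^-1 * (0 * 0).
    by rewrite mul0r mulr0 subr0 !mxE; congr (_ *+ _).
  have h : (A t (rshift 1 i) (rshift 1 j) - (a t)^-1 * (b t 0 i * b t 0 j)) @[t --> F]
      --> diag_mx d (rshift 1 i) (rshift 1 j) - (d 0 0)^-1 * (0 * 0).
    apply: (@cvgB _ _ _ _ _ (fun t => A t (rshift 1 i) (rshift 1 j))
       (fun t => (a t)^-1 * (b t 0 i * b t 0 j))); first exact: Ad.
    apply: (@cvgM _ _ _ _ (fun t => (a t)^-1) (fun t => b t 0 i * b t 0 j)) => //.
    by apply: (@cvgM _ _ _ _ (fun t => b t 0 i) (fun t => b t 0 j)).
  apply: cvg_trans h; apply: near_eq_cvg; apply: nearW => t.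
  by rewrite /C !mxE big_ord1 !mxE.
have Csym t : (C t)^T = C t.
  rewrite /C linearB linearZ /= trmx_mul trmxK; congr (_ - _).
  by rewrite trmx_drsub Asym.
have Qnear := IH (rsubmx (d : 'rV[R]_(1 + n))) C _ Csym Cd.
have apos : \forall t \near F, 0 < d 0 0 / a t.
  have h : (d 0 0 * (a t)^-1) @[t --> F] --> d 0 0 * (d 0 0)^-1.
    by apply: (@cvgM _ _ _ _ (fun=> d 0 0) (fun t => (a t)^-1)) => //; exact: cvg_cst.
  have /cvgrPdist_lt/(_ 1 ltr01) := h; apply: filterS => t.
  rewrite mulfV ?d0 // ltr_norml => /andP[_]; lra.
apply: filterS2 apos (Qnear _); last by move=> i; rewrite mxE d0.
move=> t da [Q [Qu QE]].
have a0 : a t != 0 by apply/eqP => a0; move: da; rewrite a0 invr0 mulr0 ltxx.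
pose P1 : 'M[R]_(1 + n) := block_mx 1%:M (- ((a t)^-1 *: b t)) 0 1%:M.
pose P2 : 'M[R]_(1 + n) := block_mx (Num.sqrt (d 0 0 / a t))%:M 0 0 Q.
exists (P1 *m P2); split.
  rewrite unitmx_mul; apply/andP; split.
    by rewrite unitmxE /P1 (@det_ublock _ 1 n) !det1 mulr1 unitr1.
  rewrite unitmxE /P2 (@det_ublock _ 1 n) det_scalar1 unitrM -unitmxE Qu andbT unitfE.
  by rewrite gt_eqF // sqrtr_gt0.
rewrite trmx_mul -!mulmxA (mulmxA P1^T) (mulmxA (P1^T *m _)).
have -> : P1^T *m A t *m P1 = block_mx (a t)%:M 0 0 (C t).
  by rewrite [A t]Eb block_pivot.
rewrite mulmxA; apply: etrans; first exact: block_diag_congruence.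
rewrite QE [RHS]diag_block.
by rewrite sqr_sqrtr ?ltW // divfK.
Qed.

(** The derivative of the determinant along B, first as a derivative of the
    product in the Leibniz formula, then in terms of cofactors *)
Lemma det_row_expansion (R : comNzRingType) (n : nat) (A B : 'M[R]_n) :
  \sum_i \det (\matrix_(j, k) (if j == i then B j k else A j k)) =
  \sum_i \sum_k B i k * cofactor A i k.
Proof.
apply: eq_bigr => i _; rewrite (expand_det_row _ i); apply: eq_bigr => k _.
rewrite mxE eqxx; congr (_ * (_ * \det _)).
by apply/matrixP => j l; rewrite !mxE eq_sym (negbTE (neq_lift _ _)).
Qed.

Section Metric.
Context {R : realType} {n : nat}.
Local Notation jet := (jet R n).
Implicit Types (z v : jet).

Lemma gmx_sym z : (gmx z)^T = gmx z.
Proof.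
apply/matrixP => a b; rewrite !mxE /gco; congr (z (inr (_, _))).
by apply/val_inj; rewrite /= minC maxC.
Qed.

Lemma gmx_continuous (a b : 'I_n) z : gmx y a b @[y --> z] --> gmx z a b.
Proof.
rewrite mxE; under eq_fun do rewrite mxE.
exact: jet_coord_continuous.
Qed.

(** If P diagonalizes the metric at z, then it almost does so near z. *)
Lemma lorentzian_open z : lorentzian (gmx z) ->
  \forall y \near z, lorentzian (gmx y).
Proof.
move=> [P [i0 [Pu PE]]]; set d := \row_i _ in PE.
have : \forall y \near z, exists Q : 'M[R]_n,
    Q \in unitmx /\ Q^T *m (P^T *m gmx y *m P) *m Q = diag_mx d.
  apply: (@congruence_open R jet (nbhs z) _ n d (fun y => P^T *m gmx y *m P)).
  - by move=> i; rewrite mxE; case: ifP => _; rewrite ?oppr_eq0 oner_eq0.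
  - by move=> y; rewrite !trmx_mul trmxK gmx_sym mulmxA.
  move=> i j; rewrite -PE !mxE.
  under eq_fun do rewrite mxE.
  apply: (cvg_big add_continuous) => k _.
  apply: (@cvgM _ _ _ _ (fun y : jet => (P^T *m gmx y) i k) (fun=> P k j));
    last exact: cvg_cst.
  rewrite mxE; under eq_fun do rewrite mxE.
  apply: (cvg_big add_continuous) => l _.
  apply: (@cvgM _ _ _ _ (fun=> P^T i l) (fun y : jet => gmx y l k)).
    exact: cvg_cst.
  exact: gmx_continuous.
apply: filterS => y [Q [Qu QE]]; exists (P *m Q), i0.
by rewrite unitmx_mul Pu Qu trmx_mul -QE !mulmxA.
Qed.

Lemma JLor_open (U : set 'rV[R]_n) : open U -> open (JLor U).
Proof.
rewrite !openE => oU z [Uz Lz]; apply: filterI; last exact: lorentzian_open.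
have [P Pz PU] := oU _ Uz.
have : \forall y \near z, forall j : 'I_n, P 0 j (xco j y).
  apply: (@filter_forall jet 'I_n (fun j => [set y | P 0 j (xco j y)]) (nbhs z)) => j.
  have := Pz 0 j; rewrite mxE.
  exact: jet_coord_continuous.
apply: filterS => y Py; apply: PU => i j; rewrite mxE ord1; exact: Py.
Qed.

Lemma lorentzian_det (g : 'M[R]_n) : lorentzian g -> \det g < 0.
Proof.
move=> [P [i0 [Pu /(congr1 determinant)]]].
rewrite !det_mulmx det_tr det_diag (bigD1 i0) //= mxE eqxx.
rewrite big1 ?mulr1 => [|i /negbTE i0n]; last by rewrite mxE i0n.
have P0 : 0 < (\det P) ^+ 2 by rewrite exprn_even_gt0 //= -unitfE -unitmxE.
rewrite mulrC mulrA -expr2 => h.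
by rewrite -(pmulr_rlt0 _ P0) h ltrN10.
Qed.

Lemma is_dird_prod (k : nat) (F : 'I_k -> jet -> R) (dF : 'I_k -> R) z v :
  (forall i, is_dird (F i) z v (dF i)) ->
  is_dird (fun y => \prod_i F i y) z v
    (\sum_i \prod_j (if j == i then dF j else F j z)).
Proof.
elim: k F dF => [|k IH] F dF FdF.
  rewrite big_ord0; under [X in is_dird X]funext do rewrite big_ord0.
  exact: is_dird_cst.
under [X in is_dird X]funext do rewrite big_ord_recl.
have := is_dirdM (FdF ord0) (IH _ _ (fun i => FdF (lift ord0 i))).
congr is_derive; rewrite big_ord_recl addrC; congr (_ + _).
  by rewrite big_ord_recl mulrC.
by rewrite mulr_sumr; apply: eq_bigr => i _; rewrite big_ord_recl.
Qed.

(** The trace of g^-1 h, where h is the variation of the metric along v *)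
Definition metric_trace z v : R := \sum_i \sum_k invmx (gmx z) k i * gmx v i k.

(** Jacobi's formula, by the product rule in each term of the Leibniz formula *)
Lemma is_dird_det z v : \det (gmx z) != 0 ->
  is_dird (fun y => \det (gmx y)) z v (\det (gmx z) * metric_trace z v).
Proof.
move=> dz.
have := @is_dird_sum R n _ (index_enum _) xpredT _ _ z v
  (fun s : 'S_n => is_dirdZ ((-1) ^+ s) (is_dird_prod
    (F := fun i y => gmx y i (s i)) (dF := fun i => gmx v i (s i)) (z := z) _)).
have lin i j : is_dird (fun y => gmx y i j) z v (gmx v i j).
  rewrite /is_dird /along.
  have -> : (fun t => gmx (z + t *: v) i j) = (fun t => gmx z i j + t * gmx v i j).
    by apply/funext => t; rewrite !mxE.
  rewrite -[X in is_derive _ _ _ X]add0r; apply: is_deriveD.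
  have := @is_deriveM _ _ id (fun=> gmx v i j) (0 : R) 1 1 0 (is_derive_id _ _)
    (is_derive_cst _ _ _).
  by rewrite scaler0 add0r /GRing.scale /= mulr1.
move=> /(_ (fun s i => lin i (s i))); congr is_derive.
under eq_bigr do rewrite mulr_sumr.
rewrite exchange_big /=.
transitivity (\sum_i \det (\matrix_(j, k) (if j == i then gmx v j k else gmx z j k))).
  apply: eq_bigr => i _; apply: eq_bigr => s _; congr (_ * _).
  by apply: eq_bigr => j _; rewrite [RHS]mxE.
rewrite det_row_expansion /metric_trace mulr_sumr; apply: eq_bigr => i _.
rewrite mulr_sumr; apply: eq_bigr => k _.
have -> : invmx (gmx z) k i = (\det (gmx z))^-1 * cofactor (gmx z) i k.
  by rewrite /invmx unitmxE unitfE dz mxE [in X in _ * X]mxE.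
by rewrite -[X in _ = _ * X]mulrA mulVKf // mulrC.
Qed.

Definition sqrt_det z : R := Num.sqrt (- \det (gmx z)).

Lemma is_dird_sqrt_det z v : lorentzian (gmx z) ->
  is_dird sqrt_det z v (sqrt_det z / 2 * metric_trace z v).
Proof.
move=> /lorentzian_det dz.
have dn : 0 < - \det (gmx z) by rewrite oppr_gt0.
have h : is_dird (fun y => - \det (gmx y)) z v (- (\det (gmx z) * metric_trace z v)).
  by apply: is_deriveN; apply: is_dird_det; rewrite lt_eqF.
have := @is_derive1_comp R Num.sqrt _ 0 _ _ _ h.
rewrite along0 => /(_ _ (is_derive1_sqrt dn)); congr is_derive.
rewrite -/(sqrt_det z) -mulNr -[- \det _]sqr_sqrtr ?ltW // -/(sqrt_det z).
have : sqrt_det z != 0 by rewrite gt_eqF // sqrtr_gt0.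
by move: (sqrt_det z) => q q0; field.
Qed.

Lemma gdiff_sqrt_det z : lorentzian (gmx z) -> gdiff sqrt_det z.
Proof.
move=> Lz; apply: (gdiffI (fun v => is_dird_sqrt_det v Lz)) => a u v.
have -> : metric_trace z (a *: u + v) = a * metric_trace z u + metric_trace z v.
  rewrite /metric_trace mulr_sumr -big_split; apply: eq_bigr => i _ /=.
  rewrite mulr_sumr -big_split; apply: eq_bigr => k _ /=.
  have -> : gmx (a *: u + v) i k = a * gmx u i k + gmx v i k by rewrite !mxE.
  by ring.
by ring.
Qed.

(** The contracted Christoffel symbol is half of g^(ad) g_(ad,b): its other two
    terms cancel by the symmetry of g^(ad). *)
Lemma dird_sqrt_det_hatd z (b : 'I_n) : lorentzian (gmx z) ->
  dird (hatd b z) sqrt_det z = sqrt_det z * \sum_a Gamma a a b z.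
Proof.
move=> Lz; rewrite (is_dirdE (is_dird_sqrt_det _ Lz)) -mulrA; congr (_ * _).
rewrite /Gamma -mulr_sumr; congr (_ * _).
have gs a d : invmx (gmx z) a d = invmx (gmx z) d a.
  by rewrite -[in LHS](gmx_sym z) -trmx_inv mxE.
pose S a d := invmx (gmx z) a d * gco d a (mi_incr (mi0 n) b) z.
pose T a d := invmx (gmx z) a d * gco d b (mi_incr (mi0 n) a) z.
have -> : metric_trace z (hatd b z) = \sum_a \sum_d S a d.
  rewrite /metric_trace exchange_big; apply: eq_bigr => a _; apply: eq_bigr => d _.
  by rewrite mxE.
transitivity (\sum_a \sum_d S a d + (\sum_a \sum_d T a d - \sum_a \sum_d T d a)).
  by rewrite [X in _ - X]exchange_big subrr addr0.
rewrite -sumrB -big_split; apply: eq_bigr => a _ /=.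
rewrite -sumrB -big_split; apply: eq_bigr => d _ /=.
by rewrite /S /T (gs d a); ring.
Qed.
End Metric.

(** * Divergence of vertical forms *)

Section CoordinateVolume.
Context {R : realType} {n : nat}.
Local Notation jet := (jet R n).
Local Notation jform := (jform R n).
Implicit Types (w : jform) (z v : jet) (s r : seq jet).

Lemma sum_jformE (I : Type) (t : seq I) (P : pred I) (F : I -> jform) z s :
  (\sum_(i <- t | P i) F i) z s = \sum_(i <- t | P i) F i z s.
Proof. by elim/big_ind2 : _ => // w1 x1 w2 x2 <- <-. Qed.

Definition vertical v : bool := [forall a : 'I_n, v (inl a) == 0].

(** The common value of [dx a] at all jets *)
Definition dxf (a : 'I_n) s : R := if s is [:: v] then v (inl a) else 0.

Lemma dxE (a : 'I_n) z s : dx a z s = dxf a s.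
Proof.
rewrite /dx /dxf; case: s => [|v [|v' s]]; first exact: extd_nil.
  rewrite extd_cons extd_nil subr0; apply: is_dirdE.
  rewrite /is_dird /along.
  have -> : (fun t => fun_form (xco a) (z + t *: v) [::]) =
            (fun t => z (inl a) + t * v (inl a)) by [].
  rewrite -[X in is_derive _ _ _ X]add0r; apply: is_deriveD.
  have := @is_deriveM _ _ id (fun=> v (inl a)) (0 : R) 1 1 0 (is_derive_id _ _)
    (is_derive_cst _ _ _).
  by rewrite scaler0 add0r /GRing.scale /= mulr1.
apply: (@extd_degree _ _ _ 0) => //.
by apply: filterE => y [].
Qed.

Lemma altlin_dxf a : altlin (dxf a).
Proof.
split=> [[|x [|x' s1]] [|y s2] b u v|[|x [|x' s1]] s2 u v] //=;
  by rewrite ?mulr0 ?addr0 ?oppr0.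
Qed.

Lemma kills_dxf a : kills vertical (dxf a).
Proof. by move=> [|x [|x' s1]] [|y s2] v //= /forallP /(_ a)/eqP. Qed.

(** The coordinate volume form does not depend on the jet, so that exterior
    differentiation will see it as a constant. *)
Lemma coordinate_volume : exists D : seq jet -> R,
  [/\ forall z s, (\big[wedge/fun_form (fun=> 1)]_(a < n) dx a) z s = D s,
      altlin D, kills vertical D & forall s, size s != n -> D s = 0].
Proof.
pose K (w : jform) (k : nat) := exists D : seq jet -> R,
  [/\ forall z s, w z s = D s, altlin D, kills vertical D
    & forall s, size s != k -> D s = 0].
suff : K (\big[wedge/fun_form (fun=> 1)]_(a < n) dx a) (\sum_(a < n) 1)%N.
  by rewrite sum1_card card_ord.
apply: (big_rec2 K) => [|a w k _ [D [wD DA Dk Dn]]].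
  exists (fun s => if s is [::] then 1 else 0); split=> //.
  - split=> [[|x s1] s2 b u v|[|x s1] s2 u v] //=;
      by rewrite ?mulr0 ?addr0 ?oppr0.
  - by case.
  - by case.
exists (wedgef (dxf a) D); split.
- by move=> z s; apply: eq_wedgef => r; [exact: dxE|exact: wD].
- exact: altlin_wedge (altlin_dxf a) DA.
- exact: kills_wedge (@kills_dxf a) Dk.
- move=> s; apply: wedgef_degree => //.
  by move=> [|x [|x' r]].
Qed.

Lemma hor_hatd z (a : 'I_n) : hor z (hatd a z) = hatd a z.
Proof.
rewrite /hor (bigD1 a) //= eqxx scale1r big1 ?addr0 // => b /negbTE ba.
by rewrite ba scale0r.
Qed.

Lemma vertical_ver z v : vertical (ver z v).
Proof.
apply/forallP => a; apply/eqP.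
have -> : ver z v (inl a) = v (inl a) - hor z v (inl a) by [].
have -> : hor z v (inl a) = \sum_b v (inl b) * hatd b z (inl a).
  by rewrite /hor; elim/big_ind2 : _ => // x1 y1 x2 y2 <- <-.
rewrite (bigD1 a) //= eqxx mulr1 big1 ?addr0 ?subrr // => b /negbTE ba.
by rewrite eq_sym ba mulr0.
Qed.

End CoordinateVolume.

Section VerticalForms.
Context {R : realType} {n : nat} (p : nat) (U : set 'rV[R]_n) (w : jform R n).
Hypotheses (oU : open U) (wO : Omega U p 0 w).
Local Notation jet := (jet R n).
Implicit Types (z v : jet) (s r : seq jet).

Lemma Omega_altlin z : JLor U z -> altlin (w z).
Proof.
move=> Oz; have lin := fun s1 s2 a u v => Omega_linear wO s1 s2 a u v Oz.
split=> // s1 s2 u v.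
have alt x := Omega_alternating wO s1 [::] s2 x Oz.
have add t1 t2 x y : w z (t1 ++ (x + y) :: t2) = w z (t1 ++ x :: t2) + w z (t1 ++ y :: t2).
  by have := lin t1 t2 1 x y; rewrite scale1r mul1r.
have addr x : w z (s1 ++ x :: (u + v) :: s2) =
    w z (s1 ++ x :: u :: s2) + w z (s1 ++ x :: v :: s2).
  by have := add (rcons s1 x) s2 u v; rewrite !cat_rcons.
have := alt (u + v); rewrite /= add !addr.
have /= -> := alt u; have /= -> := alt v; rewrite add0r addr0 => /eqP.
by rewrite addr_eq0 => /eqP.
Qed.

Lemma Omega_gdiffs z : JLor U z -> gdiffs w z.
Proof.
move=> Oz s; apply: Ck1_gdiff (JLor_open oU) Oz _.
exact: (Omega_smooth wO s 1).
Qed.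

Lemma Omega_degree z s : JLor U z -> size s != p -> w z s = 0.
Proof.
by move=> Oz sp; rewrite -(Omega_bidegree wO s Oz) /bipart addn0 (negbTE sp).
Qed.

(** A form of horizontal degree 0 sees only the vertical parts of its arguments,
    and a horizontal lift has none. *)
Lemma Omega_hatd z a s : JLor U z -> w z (hatd a z :: s) = 0.
Proof.
move=> Oz; rewrite -(Omega_bidegree wO _ Oz) /bipart addn0.
case: eqP => // sp; apply: big1 => m /eqP mp.
have : all id m by rewrite all_count mp -sp size_tuple.
case/tupleP : m {mp} => b m /= /andP[-> _].
rewrite {1}/ver hor_hatd subrr.
exact: (altlin0 [::] _ (Omega_altlin Oz)).
Qed.

Lemma Omega_near z : JLor U z -> \forall y \near z, JLor U y.
Proof. by move=> Oz; apply: open_nbhs_nbhs; split=> //; exact: JLor_open. Qed.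

(** The other half of Cartan's formula vanishes by [Omega_hatd]. *)
Lemma lieD_hatd z a s : JLor U z ->
  lieD (hatd a) w z s = extd w z (hatd a z :: s).
Proof.
move=> Oz; rewrite /lieD -[RHS]addr0; congr (_ + _).
rewrite (@extd_near _ _ _ (fun _ _ => 0)).
  by apply: big1 => i _; rewrite (is_dirdE (is_dird_cst _ _ _)) mulr0.
by apply: filterS (Omega_near Oz) => y Oy r; exact: Omega_hatd.
Qed.

Local Notation density := (fun y r => sqrt_det y * w y r).

Lemma density_gdiffs z : JLor U z -> gdiffs density z.
Proof.
move=> Oz s; apply: gdiffM; first exact: gdiff_sqrt_det Oz.2.
exact: Omega_gdiffs.
Qed.

Lemma density_regular z : JLor U z -> regular density z.
Proof.
move=> Oz; split; first exact: density_gdiffs.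
apply: filterS (Omega_near Oz) => y Oy.
by apply: altlin_scale; exact: Omega_altlin.
Qed.

Lemma extd_density_degree z r : JLor U z -> size r != p.+1 ->
  extd density z r = 0.
Proof.
move=> Oz; apply: extd_degree; apply: filterS (Omega_near Oz) => y Oy t tp.
by rewrite (Omega_degree Oy tp) mulr0.
Qed.

(** The Leibniz rule for contraction with a horizontal lift. The derivatives of the
    density along the remaining arguments multiply values of w on that lift,
    which are zero. *)
Lemma extd_density_hatd z a r : JLor U z ->
  extd density z (hatd a z :: r) =
  sqrt_det z * lieD (hatd a) w z r + dird (hatd a z) sqrt_det z * w z r.
Proof.
move=> Oz; have [sd _] := gdiff_sqrt_det Oz.2.
have wd t v := (Omega_gdiffs Oz t).1 v.
rewrite lieD_hatd // !extd_cons (is_dirdE (is_dirdM (sd _) (wd _ _))).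
have -> : extd (iota_ (fun=> hatd a z) density) z r =
          sqrt_det z * extd (iota_ (fun=> hatd a z) w) z r.
  rewrite /extd mulr_sumr; apply: eq_bigr => i _.
  rewrite (is_dirdE (is_dirdM (sd _) (wd _ _))) [X in _ + X * _]Omega_hatd //.
  by rewrite mul0r addr0 mulrCA.
by ring.
Qed.

End VerticalForms.

Theorem proposition3p13 (R : realType) (n p : nat) (U : set 'rV[R]_n)
    (chi : 'I_n -> jform R n) :
  open U ->
  (forall a : 'I_n, Omega U p 0 (chi a)) ->
  forall (z : jet R n) (s : seq (jet R n)), JLor U z ->
    wedge (\sum_(a < n) nabla a chi a) vol z s =
    (-1) ^+ p *
    hd p n.-1 (\sum_(a < n) wedge (chi a) (iota_ (hatd a) vol)) z s.
Proof.
move=> oU chiO z s Oz.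
have [D [DE DA Dk Dn]] := @coordinate_volume R n.
have volE y r : vol y r = sqrt_det y * D r by rewrite -(DE y).
(* lifts of the same coordinate field at two jets differ by a vertical vector *)
have Dhatd y a r : D (hatd a y :: r) = D (hatd a z :: r).
  rewrite -[hatd a y](subrK (hatd a z)) -[X in X + _]scale1r.
  rewrite (DA.1 [::]) (Dk [::]) ?mulr0 ?add0r //.
  apply/forallP => b; apply/eqP.
  by rewrite -[LHS]/((b == a)%:R - (b == a)%:R) subrr.
pose alpha a := extd (fun y r => sqrt_det y * chi a y r) z.
have lhsE : wedge (\sum_(a < n) nabla a chi a) vol z s =
    \sum_a wedgef (contract (hatd a z) (alpha a)) D s.
  rewrite -wedgef_suml -[LHS]/(wedgef _ _ s).
  rewrite (@eq_wedgef _ _ _ ((\sum_(a < n) nabla a chi a) z) (vol z)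
    (fun r => sqrt_det z * D r)) //.
  rewrite wedgef_Zr -wedgef_Zl; apply: eq_wedgef => // r.
  rewrite sum_jformE /nabla.
  rewrite (eq_bigr (fun a => lieD (hatd a) (chi a) z r +
    \sum_b Gamma a a b z * chi b z r)); last first.
    move=> a _; rewrite -[LHS]/(lieD (hatd a) (chi a) z r +
      (\sum_b fscale (Gamma a a b) (chi b)) z r).
    by rewrite sum_jformE.
  rewrite big_split /= exchange_big -big_split mulr_sumr /=; apply: eq_bigr => a _.
  rewrite /contract /alpha (extd_density_hatd oU (chiO a) _ _ Oz).
  rewrite dird_sqrt_det_hatd; last exact: Oz.2.
  by rewrite mulrDr -[in RHS]mulrA [in RHS]mulr_suml.
have psiE : \sum_(a < n) wedge (chi a) (iota_ (hatd a) vol) =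
    (fun y r => \sum_a wedgef (fun t => sqrt_det y * chi a y t) (contract (hatd a z) D) r).
  apply/funext => y; apply/funext => r; rewrite sum_jformE; apply: eq_bigr => a _.
  rewrite wedgef_Zl -wedgef_Zr; apply: eq_wedgef => // t.
  by rewrite /iota_ volE Dhatd.
have [i0 _] : exists i0 : 'I_n, True by have [_ [_ [i0 _]]] := Oz; exists i0.
have n0 : n.-1.+1 = n by rewrite prednK // (leq_ltn_trans _ (ltn_ord i0)).
rewrite lhsE /hd /bipart n0; case: eqP => [sE|/eqP sN]; last first.
  (* both sides have degree p + n *)
  rewrite mulr0; apply: big1 => a _; apply: (@wedgef_degree _ _ p n) => // r rp.
  exact: extd_density_degree oU (chiO a) _ _ Oz _.
transitivity ((-1) ^+ p * \sum_(m : (size s).-tuple bool | count id m == p)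
    \sum_a wedgef (alpha a) (contract (hatd a z) D) (splitseq (ver z) (hor z) m s)).
  rewrite [in RHS]exchange_big mulr_sumr; apply: eq_bigr => a _.
  rewrite (@split_contraction _ _ (ver z) (hor z) _ n p (fun b => hatd b z) vertical) //.
  - by rewrite mulrA -expr2 sqrr_sign mul1r.
  - by move=> v; rewrite /ver subrK.
  - exact: extd_altlin (density_regular oU (chiO a) Oz).
  - exact: vertical_ver.
  - by move=> r; exact: extd_density_degree oU (chiO a) _ _ Oz.
  - by move=> v; exists (fun b => v (inl b)).
congr (_ * _); apply: eq_bigr => m _.
rewrite psiE extd_sum => [|a].
  apply: eq_bigr => a _; apply/esym/extd_wedgef.
  exact: density_gdiffs oU (chiO a) _ Oz.
apply: (@gdiffs_wedgef _ _ (fun y t => sqrt_det y * chi a y t)).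
exact: density_gdiffs oU (chiO a) _ Oz.
Qed.
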